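(* Let $G\subset\mathbb{R}^2$ be (the open domain bounded by) a parallelogram with smallest inner angle $\alpha\in(0,\pi/2]$ and side lengths $r$ and $s$. Put \[ A=\frac{\sqrt{r^2+2rs\cos\alpha+s^2}}{\min\{r,s\}\sin\alpha}. \] Then \[ \frac12\left(A+\frac1A\right)\le P(G)\le A . \]
   Context: For four distinct points $a,b,c,d\in\mathbb{R}^2$ set $p(a,b,c,d)=\frac{|a-b||c-d|+|a-d||b-c|}{|a-c||b-d|}$. For a domain $D$ whose boundary is a Jordan curve, the Ptolemy constant is $P(D)=\sup p(a,b,c,d)$ over all distinct $a,b,c,d\in\partial D$ occurring in this order when $\partial D$ is traversed in the positive direction. *)

(* Defs.v *)
From Stdlib Require Import Reals Lra.
Open Scope R_scope.

Definition pt := (R * R)%type.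

Definition dist (a b : pt) : R :=
  sqrt ((fst a - fst b)^2 + (snd a - snd b)^2).

Definition ptol (a b c d : pt) : R :=
  (dist a b * dist c d + dist a d * dist b c) / (dist a c * dist b d).

Definition padd (a b : pt) : pt := (fst a + fst b, snd a + snd b).
Definition pscale (k : R) (a : pt) : pt := (k * fst a, k * snd a).

(* Parallelogram with base vertex p0, side lengths r, s, inner angle al
   between the sides, rotated by theta.  Edge vectors
   u = r (cos theta, sin theta), w = s (cos (theta+al), sin (theta+al)),
   so det(u,w) = r s sin al > 0: vertices V0 = p0, V1 = p0+u,
   V2 = p0+u+w, V3 = p0+w are listed counterclockwise. *)
Definition edge_u (r theta : R) : pt := (r * cos theta, r * sin theta).
Definition edge_w (s al theta : R) : pt :=
  (s * cos (theta + al), s * sin (theta + al)).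

(* Positively oriented parametrization of the boundary on [0,4). *)
Definition par_boundary (p0 : pt) (r s al theta : R) (t : R) : pt :=
  let u := edge_u r theta in
  let w := edge_w s al theta in
  if Rlt_dec t 1 then padd p0 (pscale t u)
  else if Rlt_dec t 2 then padd (padd p0 u) (pscale (t - 1) w)
  else if Rlt_dec t 3 then padd (padd p0 (padd u w)) (pscale (-(t - 2)) u)
  else padd (padd p0 w) (pscale (-(t - 3)) w).

Definition lin_order (gamma : R -> pt) (a b c d : pt) : Prop :=
  exists t1 t2 t3 t4, 0 <= t1 < t2 /\ t2 < t3 /\ t3 < t4 /\ t4 < 4 /\
    gamma t1 = a /\ gamma t2 = b /\ gamma t3 = c /\ gamma t4 = d.

Definition cyc_order (gamma : R -> pt) (a b c d : pt) : Prop :=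
  lin_order gamma a b c d \/ lin_order gamma b c d a \/
  lin_order gamma c d a b \/ lin_order gamma d a b c.

Definition ptolemy_values (gamma : R -> pt) (x : R) : Prop :=
  exists a b c d : pt,
    a <> b /\ a <> c /\ a <> d /\ b <> c /\ b <> d /\ c <> d /\
    cyc_order gamma a b c d /\ x = ptol a b c d.

Definition is_ptolemy_constant (gamma : R -> pt) (P : R) : Prop :=
  is_lub (ptolemy_values gamma) P.

(* Main.v *)
From Stdlib Require Import Reals Lra Psatz.
Require Import Defs.
Open Scope R_scope.

(** With [z1 = (a-b)(c-d)] and [z2 = (a-d)(b-c)] in complex notation,
    [ptol a b c d = (|z1| + |z2|) / |z1 + z2|], and the angle between [z1] and [z2]
    is [|PI - (angle a + angle c)|].  Hence [ptol a b c d <= 1 / sin beta] as soon as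
    both sums of opposite angles of the quadrilateral are at least [2 beta].  Let
    [beta] be the angle between the long diagonal and a long side, so that
    [1 / sin beta = A].  If [b] and [d] lie on opposite sides of the parallelogram,
    the angles at [a] and [c] are each at least [beta]: by convexity in each point it
    suffices to look at vertices.  If [b] and [d] lie on the same or on adjacent
    sides, then [a] or [c] sits between them near a corner, where its angle is at
    least the smallest inner angle, which is at least [2 beta].
    The lower bound is attained by the ends of the long diagonal together with the
    feet of the common perpendicular of the long sides through the centre. *)

(** * The unit square as an affine model of the parallelogram *)

(** All case distinctions over sides are made on the square; the metric of the parallelogram enters
    only through [form]. The value at 4 is again the starting corner. *)
Definition square_boundary (t : R) : pt :=
  if Rlt_dec t 1 then (t, 0)
  else if Rlt_dec t 2 then (1, t - 1)
  else if Rlt_dec t 3 then (3 - t, 1)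
  else (0, 4 - t).

Definition det (o a b : pt) : R :=
  (fst a - fst o) * (snd b - snd o) - (snd a - snd o) * (fst b - fst o).

(* Scalar product of [a - o] and [b - o] in a basis with Gram matrix [[E,F],[F,G]]. *)
Definition form (E F G : R) (o a b : pt) : R :=
  E * ((fst a - fst o) * (fst b - fst o))
  + F * ((fst a - fst o) * (snd b - snd o) + (snd a - snd o) * (fst b - fst o))
  + G * ((snd a - snd o) * (snd b - snd o)).

Ltac split_sides :=
  repeat match goal with |- context [Rlt_dec ?x ?y] => destruct (Rlt_dec x y) end;
  try lra; cbn [fst snd]; try lra.

Lemma det_square_boundary_nonneg (t1 t2 t3 : R) :
  0 <= t1 <= t2 -> t2 <= t3 <= 4 ->
  0 <= det (square_boundary t1) (square_boundary t2) (square_boundary t3).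
Proof.
  intros H1 H2; unfold det, square_boundary; split_sides; nra.
Qed.

(** * Angle bounds on the square *)

(** The apex lies on the same side as one neighbour, at distance [l] from it; [v] is the signed
    offset of the other neighbour along that side. The worst case [v = 1] is a diagonal. *)
Lemma form_adjacent_vertex (E F K l v : R) :
  0 <= E -> E + F <= K -> 0 <= l -> v <= 1 -> E * (v * l) + F * l <= K * l.
Proof.
  intros HE HK Hl Hv.
  assert (E * v <= E) by nra.
  nra.
Qed.

(** The apex has position [t] on a side joining the two opposite sides; [p] and [q] are the
    distances of its neighbours from that side. The [G] term is favourable, and [p q = t p q + (1 -
    t) p q <= t q + p (1 - t)] reduces the rest to [E + F] and [E - F]. *)
Lemma form_opposite_vertex (E F G K p q t : R) :
  0 <= E -> 0 <= G -> E + F <= K -> E - F <= K ->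
  0 <= p <= 1 -> 0 <= q <= 1 -> 0 <= t <= 1 ->
  E * (p * q) + F * (t * q - p * (1 - t)) - G * (t * (1 - t))
    <= K * (t * q + p * (1 - t)).
Proof.
  intros HE HG H1 H2 Hp Hq Ht.
  assert (Htq : 0 <= t * q) by nra.
  assert (Htp : 0 <= p * (1 - t)) by nra.
  assert (Hpq : p * q <= t * q + p * (1 - t)) by nra.
  assert (0 <= G * (t * (1 - t))) by (repeat apply Rmult_le_pos; lra).
  assert (E * (p * q) <= E * (t * q + p * (1 - t))) by nra.
  nra.
Qed.

Ltac use_bound h :=
  let H := fresh in
  pose proof h as H;
  repeat (specialize (H ltac:(repeat split; lra)));
  lra.

(** A symmetry of the square brings each position into one of two normal forms; it may swap [E] with
    [G] and negate [F]. *)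
Ltac opposite_sides E F G K ta tb td :=
  first
  [ use_bound (form_opposite_vertex E F G K (1 - tb) (td - 2) (ta - 1))
  | use_bound (form_opposite_vertex E F G K (3 - td) tb (ta - 3))
  | use_bound (form_opposite_vertex G (- F) E K (2 - tb) (td - 3) (ta - 2))
  | use_bound (form_opposite_vertex G F E K (tb - 1) (4 - td) (1 - ta))
  | use_bound (form_adjacent_vertex E (- F) K (ta - tb) (ta + td - 3))
  | use_bound (form_adjacent_vertex E F K (tb - ta) (3 - ta - td))
  | use_bound (form_adjacent_vertex E F K (td - ta) (3 - ta - tb))
  | use_bound (form_adjacent_vertex E (- F) K (ta - td) (ta + tb - 3))
  | use_bound (form_adjacent_vertex G F K (ta - tb) (ta + td - 5))
  | use_bound (form_adjacent_vertex G (- F) K (tb - ta) (5 - ta - td))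
  | use_bound (form_adjacent_vertex G (- F) K (td - ta) (5 - ta - tb))
  | use_bound (form_adjacent_vertex G F K (ta - td) (ta + tb - 5))].

(** On one leg of a corner the apex is at distance [y] from its neighbour and [x] from the corner;
    the other neighbour is at distance [z] on the other leg. By the exterior angle theorem the angle
    is at least the corner angle. With [z = 0] the lemma also covers three points on one side. *)
Lemma form_near_corner (E F N x y z : R) :
  0 <= E -> - N <= F -> 0 <= x -> 0 <= y -> 0 <= z ->
  - E * (x * y) - F * (z * y) <= N * (z * y).
Proof.
  intros HE HN Hx Hy Hz.
  assert (0 <= x * y) by nra.
  assert (0 <= z * y) by nra.
  nra.
Qed.

Ltac near_corner E F G N tb tc td :=
  first
  [ use_bound (form_near_corner E F N (td - tc) (tc - tb) 0)
  | use_bound (form_near_corner G F N (td - tc) (tc - tb) 0)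
  | use_bound (form_near_corner E F N (1 - tc) (tc - tb) (td - 1))
  | use_bound (form_near_corner G F N (tc - 1) (td - tc) (1 - tb))
  | use_bound (form_near_corner G (- F) N (2 - tc) (tc - tb) (td - 2))
  | use_bound (form_near_corner E (- F) N (tc - 2) (td - tc) (2 - tb))
  | use_bound (form_near_corner E F N (3 - tc) (tc - tb) (td - 3))
  | use_bound (form_near_corner G F N (tc - 3) (td - tc) (3 - tb))
  | use_bound (form_near_corner G (- F) N (4 - tc) (tc - td) tb)
  | use_bound (form_near_corner E (- F) N tc (tb - tc) (4 - td))].

Lemma form_inner_opposite (E F G K tb tc td : R) :
  0 <= E -> 0 <= G -> E + F <= K -> E - F <= K -> G + F <= K -> G - F <= K ->
  0 <= tb <= tc -> tc <= td <= 4 ->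
  (tb < 1 /\ 2 <= td < 3) \/ (1 <= tb < 2 /\ 3 <= td) ->
  let b := square_boundary tb in
  let c := square_boundary tc in
  let d := square_boundary td in
  form E F G c d b <= K * det c d b.
Proof.
  intros HE HG H1 H2 H3 H4 Hb Hc Hs; cbv zeta.
  unfold form, det, square_boundary; split_sides.
  all: opposite_sides E F G K tc tb td.
Qed.

Lemma form_outer_opposite (E F G K ta tb td : R) :
  0 <= E -> 0 <= G -> E + F <= K -> E - F <= K -> G + F <= K -> G - F <= K ->
  0 <= ta <= 4 -> 0 <= tb <= 4 -> td <= 4 -> ta <= tb \/ td <= ta ->
  (tb < 1 /\ 2 <= td < 3) \/ (1 <= tb < 2 /\ 3 <= td) ->
  let a := square_boundary ta in
  let b := square_boundary tb in
  let d := square_boundary td in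
  form E F G a b d <= K * det a b d.
Proof.
  intros HE HG H1 H2 H3 H4 Ha Hb Hd Hc Hs; cbv zeta.
  unfold form, det, square_boundary; split_sides.
  all: opposite_sides E F G K ta tb td.
Qed.

Lemma form_inner_adjacent (E F G N tb tc td : R) :
  0 <= E -> 0 <= G -> - N <= F <= N ->
  0 <= tb <= tc -> tc <= td <= 4 ->
  td < 2 \/ (1 <= tb /\ td < 3) \/ 2 <= tb ->
  let b := square_boundary tb in
  let c := square_boundary tc in
  let d := square_boundary td in
  form E F G c d b <= N * det c d b.
Proof.
  intros HE HG HN Hb Hc Hs; cbv zeta.
  unfold form, det, square_boundary; split_sides.
  all: near_corner E F G N tb tc td.
Qed.

(** The sides of [b] and [d] meet at the corner with parameter 0, so the vertex near that corner is
    the one outside the parameter interval from [tb] to [td]. *)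
Lemma form_outer_adjacent (E F G N ta tb td : R) :
  0 <= E -> 0 <= G -> - N <= F <= N ->
  0 <= ta <= 4 -> 0 <= tb < 1 -> 3 <= td <= 4 -> ta <= tb \/ td <= ta ->
  let a := square_boundary ta in
  let b := square_boundary tb in
  let d := square_boundary td in
  form E F G a b d <= N * det a b d.
Proof.
  intros HE HG HN Ha Hb Hd Hc; cbv zeta.
  unfold form, det, square_boundary; split_sides.
  all: near_corner E F G N tb ta td.
Qed.

(** * Opposite angles of a quadrilateral and the Ptolemy ratio *)

Definition dot (o a b : pt) : R :=
  (fst a - fst o) * (fst b - fst o) + (snd a - snd o) * (snd b - snd o).

(* Here [xa + i ya] and [xc + i yc] have the opposite angles as arguments, [W] is the
   modulus of their product and [k = cot beta], so that [2 k / (k^2 - 1)] is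
   [tan (2 beta)] and [(k^2 - 1) / (k^2 + 1)] is [cos (2 beta)].  The second
   alternative of the conclusion is the degenerate case of two straight angles. *)
Lemma angle_sum_bound (k xa ya xc yc W : R) :
  1 <= k -> 0 <= ya -> 0 <= yc -> 0 <= W ->
  W ^ 2 = (xa ^ 2 + ya ^ 2) * (xc ^ 2 + yc ^ 2) ->
  0 <= xa * yc + xc * ya ->
  (xa <= k * ya /\ xc <= k * yc) \/
  2 * k * xa <= (k ^ 2 - 1) * ya \/ 2 * k * xc <= (k ^ 2 - 1) * yc ->
  (xa * xc - ya * yc) * (k ^ 2 + 1) <= (k ^ 2 - 1) * W \/
  (xa < 0 /\ xc < 0 /\ xa * yc + xc * ya = 0).
Proof.
  intros Hk Hya Hyc HW HW2 HY Htri.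
  set (X := xa * xc - ya * yc) in *.
  set (Y := xa * yc + xc * ya) in *.
  assert (HXY : W ^ 2 = X ^ 2 + Y ^ 2) by (rewrite HW2; unfold X, Y; ring).
  assert (Hk2 : 0 <= k ^ 2 - 1) by nra.
  destruct (Rle_dec X 0) as [HX | HX].
  { left; assert (0 <= (k ^ 2 - 1) * W) by (apply Rmult_le_pos; lra); nra. }
  assert (Hprod : 0 < xa * xc) by (unfold X in HX; nra).
  destruct (Rlt_dec xa 0) as [Hxa | Hxa].
  { right; assert (xc < 0) by nra.
    repeat split; [lra | lra | ]. unfold Y in *.
    assert (xa * yc <= 0) by nra.
    assert (xc * ya <= 0) by nra.
    lra. }
  left.
  assert (Hxa' : 0 < xa).
  { destruct (Req_dec xa 0) as [H | H]; [rewrite H in Hprod |]; lra. }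
  assert (Hxc : 0 < xc) by nra.
  (* Both angles are acute now, so the tangent of their sum is compared with [tan (2 beta)]. *)
  assert (Htan : 2 * k * X <= (k ^ 2 - 1) * Y).
  { destruct Htri as [[H1 H2] | [H1 | H2]].
    (* This expression equals [k * ((k ^ 2 - 1) * Y - 2 * k * X)]. *)
    - assert (0 <= (xa * (k * yc - xc) + xc * (k * ya - xa)) * (k ^ 2 + 1)
                   + 2 * ((k * ya - xa) * (k * yc - xc))).
      { assert (0 <= xa * (k * yc - xc)) by (apply Rmult_le_pos; lra).
        assert (0 <= xc * (k * ya - xa)) by (apply Rmult_le_pos; lra).
        assert (0 <= (k * ya - xa) * (k * yc - xc)) by (apply Rmult_le_pos; lra).
        nra. }
      apply Rmult_le_reg_l with k; [lra |]. unfold X, Y; lra.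
    - assert (0 <= (k ^ 2 - 1) * (xa * yc)) by (apply Rmult_le_pos; nra).
      assert (xc * (2 * k * xa) <= xc * ((k ^ 2 - 1) * ya)) by nra.
      assert (0 <= k * (ya * yc)) by (apply Rmult_le_pos; nra).
      unfold X, Y; lra.
    - assert (0 <= (k ^ 2 - 1) * (xc * ya)) by (apply Rmult_le_pos; nra).
      assert (xa * (2 * k * xc) <= xa * ((k ^ 2 - 1) * yc)) by nra.
      assert (0 <= k * (ya * yc)) by (apply Rmult_le_pos; nra).
      unfold X, Y; lra. }
  apply Rsqr_incr_0_var; [| apply Rmult_le_pos; lra].
  unfold Rsqr.
  (* Since [(k^2 + 1)^2 - (k^2 - 1)^2 = (2 k)^2], this turns the tangent bound into the cosine
     bound. *)
  assert ((2 * k * X) ^ 2 <= ((k ^ 2 - 1) * Y) ^ 2).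
  { apply pow_incr; split; [| lra]. apply Rmult_le_pos; lra. }
  replace ((k ^ 2 - 1) * W * ((k ^ 2 - 1) * W))
    with ((k ^ 2 - 1) ^ 2 * W ^ 2) by ring.
  rewrite HXY. lra.
Qed.

(* For [k = cot beta]: the angles at [a] and [c] are both at least [beta], or one of
   them is at least [2 beta]. *)
Definition opposite_angles_wide (k : R) (a b c d : pt) : Prop :=
  0 <= det a b d /\ 0 <= det c d b /\
  ((dot a b d <= k * det a b d /\ dot c d b <= k * det c d b) \/
   2 * k * dot a b d <= (k ^ 2 - 1) * det a b d \/
   2 * k * dot c d b <= (k ^ 2 - 1) * det c d b).

Lemma dist_nonneg (a b : pt) : 0 <= dist a b.
Proof. apply sqrt_pos. Qed.

Lemma dist_sqr (a b : pt) :
  dist a b ^ 2 = (fst a - fst b) ^ 2 + (snd a - snd b) ^ 2.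
Proof.
  unfold dist; rewrite <- Rsqr_pow2, Rsqr_sqrt; [reflexivity |].
  apply Rplus_le_le_0_compat; apply pow2_ge_0.
Qed.

Lemma dist_pos (a b : pt) : a <> b -> 0 < dist a b.
Proof.
  intros Hab; destruct (Rle_lt_or_eq_dec 0 (dist a b) (dist_nonneg a b)) as [H | H];
    [exact H | exfalso].
  apply Hab; pose proof (dist_sqr a b) as Hs; rewrite <- H in Hs.
  destruct a as [a1 a2], b as [b1 b2]; cbn [fst snd] in Hs.
  pose proof (pow2_ge_0 (a1 - b1)); pose proof (pow2_ge_0 (a2 - b2)).
  f_equal; apply Rminus_diag_uniq, Rsqr_0_uniq; rewrite Rsqr_pow2; lra.
Qed.

Lemma ptol_rotate (a b c d : pt) : ptol a b c d = ptol b c d a.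
Proof.
  assert (Hs : forall x y, dist x y = dist y x).
  { intros x y; unfold dist; f_equal; ring. }
  unfold ptol; rewrite (Hs b a), (Hs d a), (Hs c a); f_equal; ring.
Qed.

(** [X] is [W] times the cosine of the angle sum at [a] and [c], so bounding [X] bounds the product
    of the diagonals below by the law of cosines [Hdiag]. For [k = cot beta] the right side is
    [1 / sin beta]. *)
Lemma ptol_le_of_wide (k : R) (a b c d : pt) :
  1 <= k -> a <> c -> b <> d ->
  opposite_angles_wide k a b c d -> opposite_angles_wide k b c d a ->
  ptol a b c d <= sqrt (1 + k ^ 2).
Proof.
  intros Hk Hac Hbd (Ha & Hc & Hactri) (Hb & Hd & Hbdtri).
  set (W := (dist a b * dist c d) * (dist a d * dist b c)).
  set (X := dot a b d * dot c d b - det a b d * det c d b).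
  assert (HW : 0 <= W) by (repeat apply Rmult_le_pos; apply dist_nonneg).
  assert (HW2 : W ^ 2 = (dist a b ^ 2 * dist c d ^ 2) * (dist a d ^ 2 * dist b c ^ 2))
    by (unfold W; ring).
  assert (HWac : W ^ 2 = (dot a b d ^ 2 + det a b d ^ 2) * (dot c d b ^ 2 + det c d b ^ 2)).
  { rewrite HW2, !dist_sqr; unfold dot, det; ring. }
  assert (HWbd : W ^ 2 = (dot b c a ^ 2 + det b c a ^ 2) * (dot d a c ^ 2 + det d a c ^ 2)).
  { rewrite HW2, !dist_sqr; unfold dot, det; ring. }
  assert (HXbd : dot b c a * dot d a c - det b c a * det d a c = X)
    by (unfold X, dot, det; ring).
  assert (HYbd : dot b c a * det d a c + dot d a c * det b c a
                 = - (dot a b d * det c d b + dot c d b * det a b d))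
    by (unfold dot, det; ring).
  (* Hence the four angles cannot all be straight. *)
  assert (Hdots : 0 <= dot a b d + dot b c a + dot c d b + dot d a c).
  { replace (dot a b d + dot b c a + dot c d b + dot d a c)
      with ((fst b + fst d - fst a - fst c) ^ 2 + (snd b + snd d - snd a - snd c) ^ 2)
      by (unfold dot; ring).
    apply Rplus_le_le_0_compat; apply pow2_ge_0. }
  (* By [HYbd] the sines of the two opposite angle sums are negatives of each other, so
     [angle_sum_bound] applies to at least one pair, and to both when they vanish. *)
  assert (HX : X * (k ^ 2 + 1) <= (k ^ 2 - 1) * W).
  { assert (Hcase_ac := angle_sum_bound k _ _ _ _ W Hk Ha Hc HW HWac).
    assert (Hcase_bd := angle_sum_bound k _ _ _ _ W Hk Hb Hd HW HWbd).
    rewrite HXbd in Hcase_bd; fold X in Hcase_ac.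
    destruct (Rle_dec 0 (dot a b d * det c d b + dot c d b * det a b d)) as [HY | HY].
    - destruct (Hcase_ac HY Hactri) as [H | (H1 & H2 & H3)]; [exact H |].
      destruct Hcase_bd as [H | (H4 & H5 & _)]; [lra | exact Hbdtri | exact H | lra].
    - destruct Hcase_bd as [H | (_ & _ & H)]; [lra | exact Hbdtri | exact H | lra]. }
  assert (Hdiag : (dist a c * dist b d) ^ 2
                  = (dist a b * dist c d) ^ 2 + (dist a d * dist b c) ^ 2 - 2 * X).
  { rewrite !Rpow_mult_distr, !dist_sqr; unfold X, dot, det; ring. }
  assert (Hpos : 0 < dist a c * dist b d)
    by (apply Rmult_lt_0_compat; apply dist_pos; assumption).
  unfold ptol; apply Rmult_le_reg_r with (dist a c * dist b d); [exact Hpos |].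
  unfold Rdiv; rewrite Rmult_assoc, Rinv_l, Rmult_1_r by lra.
  apply Rsqr_incr_0_var; [| apply Rmult_le_pos; [apply sqrt_pos | lra]].
  rewrite Rsqr_mult, Rsqr_sqrt by nra.
  rewrite !Rsqr_pow2, Hdiag.
  unfold W in HX.
  set (x := dist a b * dist c d) in *; set (y := dist a d * dist b c) in *.
  (* This square is the slack left after inserting the bound on [X]. *)
  assert (0 <= (k * (x - y)) ^ 2) by apply pow2_ge_0.
  lra.
Qed.

(** * Transfer of the angle bounds to the parallelogram *)

Definition affine (p0 u w q : pt) : pt :=
  padd p0 (padd (pscale (fst q) u) (pscale (snd q) w)).

Lemma det_affine (p0 u w o a b : pt) :
  det (affine p0 u w o) (affine p0 u w a) (affine p0 u w b)
  = (fst u * snd w - snd u * fst w) * det o a b.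
Proof. unfold det, affine, padd, pscale; cbn [fst snd]; ring. Qed.

Lemma dot_affine (p0 u w o a b : pt) :
  dot (affine p0 u w o) (affine p0 u w a) (affine p0 u w b)
  = form (fst u ^ 2 + snd u ^ 2) (fst u * fst w + snd u * snd w)
         (fst w ^ 2 + snd w ^ 2) o a b.
Proof. unfold dot, form, affine, padd, pscale; cbn [fst snd]; ring. Qed.

Lemma par_boundary_affine (p0 : pt) (r s al theta t : R) :
  par_boundary p0 r s al theta t
  = affine p0 (edge_u r theta) (edge_w s al theta) (square_boundary t).
Proof.
  unfold par_boundary, square_boundary, affine.
  repeat destruct Rlt_dec; unfold padd, pscale; cbn [fst snd]; f_equal; ring.
Qed.

Lemma edges_dot (r s al theta : R) :
  fst (edge_u r theta) * fst (edge_w s al theta)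
  + snd (edge_u r theta) * snd (edge_w s al theta) = r * s * cos al.
Proof.
  unfold edge_u, edge_w; cbn [fst snd].
  replace (cos al) with (cos (theta + al - theta)) by (f_equal; ring).
  rewrite cos_minus; ring.
Qed.

Lemma edges_det (r s al theta : R) :
  fst (edge_u r theta) * snd (edge_w s al theta)
  - snd (edge_u r theta) * fst (edge_w s al theta) = r * s * sin al.
Proof.
  unfold edge_u, edge_w; cbn [fst snd].
  replace (sin al) with (sin (theta + al - theta)) by (f_equal; ring).
  rewrite sin_minus; ring.
Qed.

Lemma polar_sqr (r t : R) : (r * cos t) ^ 2 + (r * sin t) ^ 2 = r ^ 2.
Proof.
  pose proof (sin2_cos2 t) as H; rewrite !Rsqr_pow2 in H.
  replace ((r * cos t) ^ 2 + (r * sin t) ^ 2) 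
    with (r ^ 2 * (sin t ^ 2 + cos t ^ 2)) by ring.
  rewrite H; ring.
Qed.

Ltac tauto_lra := first [lra | left; tauto_lra | right; tauto_lra].

Lemma par_boundary_wide (p0 : pt) (r s al theta k ta tb tc td : R) :
  0 < r -> 0 < s -> 0 < sin al -> 0 <= cos al -> 1 <= k ->
  r ^ 2 + r * s * cos al <= k * (r * s * sin al) ->
  s ^ 2 + r * s * cos al <= k * (r * s * sin al) ->
  0 <= ta < 4 -> 0 <= tb < tc -> tc < td < 4 -> ta < tb \/ td < ta ->
  let g := par_boundary p0 r s al theta in
  opposite_angles_wide k (g ta) (g tb) (g tc) (g td).
Proof.
  intros Hr Hs Hsin Hcos Hk Hkr Hks Hta Htb Htd Hout g.
  assert (HF : 0 <= r * s * cos al) by (repeat apply Rmult_le_pos; lra).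
  assert (HD : 0 < r * s * sin al) by (repeat apply Rmult_lt_0_compat; lra).
  set (F := r * s * cos al) in *; set (D := r * s * sin al) in *.
  assert (HEG : r ^ 2 * s ^ 2 = F ^ 2 + D ^ 2).
  { unfold F, D; pose proof (sin2_cos2 al) as H; rewrite !Rsqr_pow2 in H.
    replace ((r * s * cos al) ^ 2 + (r * s * sin al) ^ 2)
      with (r ^ 2 * s ^ 2 * (sin al ^ 2 + cos al ^ 2)) by ring.
    rewrite H; ring. }
  (* The two side hypotheses multiply to [r^2 s^2 <= (k D - F)^2]; with [HEG] this gives
     [cot al <= cot (2 beta)], that is [al >= 2 beta]. *)
  assert (HN : 2 * k * F <= (k ^ 2 - 1) * D).
  { assert (r ^ 2 * s ^ 2 <= (k * D - F) * (k * D - F))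
      by (apply Rmult_le_compat; nra).
    apply Rmult_le_reg_l with D; [exact HD | nra]. }
  (* [N = D cot (2 beta)], while [F = D cot al]. *)
  set (N := (k ^ 2 - 1) * D / (2 * k)).
  assert (HN' : 2 * k * N = (k ^ 2 - 1) * D) by (unfold N; field; lra).
  assert (HFN : - N <= F <= N) by (split; nra).
  assert (Hdet : forall x y z, det (g x) (g y) (g z)
     = D * det (square_boundary x) (square_boundary y) (square_boundary z)).
  { intros; unfold g; rewrite !par_boundary_affine, det_affine, edges_det; reflexivity. }
  assert (Hdot : forall x y z, dot (g x) (g y) (g z)
     = form (r ^ 2) F (s ^ 2) (square_boundary x) (square_boundary y) (square_boundary z)).
  { intros; unfold g; rewrite !par_boundary_affine, dot_affine, edges_dot.
    unfold edge_u, edge_w; cbn [fst snd]; rewrite !polar_sqr; reflexivity. }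
  assert (Hcyc : forall o a b, det o a b = det a b o) by (intros; unfold det; ring).
  assert (HE : 0 <= r ^ 2) by apply pow2_ge_0.
  assert (HG : 0 <= s ^ 2) by apply pow2_ge_0.
  unfold opposite_angles_wide; rewrite !Hdet, !Hdot.
  assert (Hcorner : forall o a b,
    form (r ^ 2) F (s ^ 2) o a b <= N * det o a b ->
    2 * k * form (r ^ 2) F (s ^ 2) o a b <= (k ^ 2 - 1) * (D * det o a b)).
  { intros o a b H.
    replace ((k ^ 2 - 1) * (D * det o a b)) with (2 * k * (N * det o a b))
      by (rewrite <- !Rmult_assoc, HN'; ring).
    apply Rmult_le_compat_l; lra. }
  assert (Hside : forall o a b,
    form (r ^ 2) F (s ^ 2) o a b <= (k * D) * det o a b ->
    form (r ^ 2) F (s ^ 2) o a b <= k * (D * det o a b)) by (intros; lra).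
  split; [| split].
  - apply Rmult_le_pos; [lra |].
    destruct Hout.
    + apply det_square_boundary_nonneg; lra.
    + rewrite Hcyc; apply det_square_boundary_nonneg; lra.
  - apply Rmult_le_pos; [lra |].
    rewrite Hcyc, Hcyc; apply det_square_boundary_nonneg; lra.
  - assert (Hout' : ta <= tb \/ td <= ta) by (destruct Hout; [left | right]; lra).
    (* The sides of [b] and [d] decide: meeting at parameter 0, the angle at [a] is large; equal or
       consecutive otherwise, the angle at [c]; opposite, both angles count. *)
    destruct (Rlt_dec tb 1), (Rlt_dec td 3).
    all: try destruct (Rlt_dec td 2).
    all: try destruct (Rlt_dec tb 2).
    all: try lra.
    all: first
      [ right; left; apply Hcorner, form_outer_adjacent; assumption || lra
      | right; right; apply Hcorner, form_inner_adjacent; first [lra | tauto_lra]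
      | left; split; apply Hside;
        [apply form_outer_opposite | apply form_inner_opposite];
        first [assumption | lra | tauto_lra] ].
Qed.

(** * The Ptolemy ratio of a parallelogram *)

(** Opposite sides are equal, so the numerator is a sum of two squares, which the parallelogram law
    expresses by the diagonals. *)
Lemma ptol_parallelogram (a b c d : pt) :
  a <> c -> b <> d ->
  fst a + fst c = fst b + fst d -> snd a + snd c = snd b + snd d ->
  let q := dist a c / dist b d in
  ptol a b c d = 1 / 2 * (q + 1 / q).
Proof.
  intros Hac Hbd H1 H2 q.
  apply dist_pos in Hac; apply dist_pos in Hbd.
  assert (Hcd : dist c d = dist a b).
  { unfold dist; f_equal.
    replace (fst c - fst d) with (fst b - fst a) by lra.
    replace (snd c - snd d) with (snd b - snd a) by lra.
    ring. }
  assert (Hbc : dist b c = dist a d).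
  { unfold dist; f_equal.
    replace (fst b - fst c) with (fst a - fst d) by lra.
    replace (snd b - snd c) with (snd a - snd d) by lra.
    ring. }
  assert (Hlaw : 2 * (dist a b ^ 2 + dist a d ^ 2) = dist a c ^ 2 + dist b d ^ 2).
  { rewrite !dist_sqr.
    replace (fst d) with (fst a + fst c - fst b) by lra.
    replace (snd d) with (snd a + snd c - snd b) by lra.
    ring. }
  unfold ptol, q; rewrite Hcd, Hbc.
  replace (dist a b * dist a b + dist a d * dist a d)
    with ((dist a c ^ 2 + dist b d ^ 2) / 2) by lra.
  field; lra.
Qed.

(** * The upper bound *)

Lemma cyc_order_bound (gamma : R -> pt) (M : R) :
  (forall a b c d, a <> c -> b <> d -> lin_order gamma a b c d -> ptol a b c d <= M) ->
  is_upper_bound (ptolemy_values gamma) M.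
Proof.
  intros HM x (a & b & c & d & _ & Hac & _ & _ & Hbd & _ & Hcyc & ->).
  destruct Hcyc as [H | [H | [H | H]]].
  - apply HM; assumption.
  - rewrite ptol_rotate; apply HM; auto.
  - rewrite 2!ptol_rotate; apply HM; auto.
  - rewrite 3!ptol_rotate; apply HM; auto.
Qed.

Lemma par_boundary_upper (p0 : pt) (r s al theta k : R) :
  0 < r -> 0 < s -> 0 < sin al -> 0 <= cos al -> 1 <= k ->
  r ^ 2 + r * s * cos al <= k * (r * s * sin al) ->
  s ^ 2 + r * s * cos al <= k * (r * s * sin al) ->
  is_upper_bound (ptolemy_values (par_boundary p0 r s al theta)) (sqrt (1 + k ^ 2)).
Proof.
  intros Hr Hs Hsin Hcos Hk Hkr Hks; apply cyc_order_bound.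
  intros a b c d Hac Hbd (t1 & t2 & t3 & t4 & H1 & H2 & H3 & H4 & <- & <- & <- & <-).
  apply ptol_le_of_wide; try assumption.
  - apply par_boundary_wide; try assumption; try lra; left; lra.
  (* Exchanging the vertices of both opposite pairs makes the last point the outer vertex and keeps
     the other three in increasing order. *)
  - enough (Hw : opposite_angles_wide k (par_boundary p0 r s al theta t4)
       (par_boundary p0 r s al theta t1) (par_boundary p0 r s al theta t2)
       (par_boundary p0 r s al theta t3)).
    { unfold opposite_angles_wide in *; tauto. }
    apply par_boundary_wide; try assumption; try lra; right; lra.
Qed.

(** * The lower bound from centrally symmetric quadruples *)

(** [g (2 + t)] is the reflection of [g t] in the centre, so the four points form a
    parallelogram. *)
Lemma par_boundary_symmetric_value (p0 : pt) (r s al theta t : R) :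
  0 < r -> 0 < s -> 0 < sin al -> 0 < t < 2 ->
  let g := par_boundary p0 r s al theta in
  let q := dist (g 0) (g 2) / dist (g t) (g (2 + t)) in
  ptolemy_values g (1 / 2 * (q + 1 / q)).
Proof.
  intros Hr Hs Hsin Ht g q.
  assert (HD : 0 < r * s * sin al) by (repeat apply Rmult_lt_0_compat; lra).
  (* Distinctness is read off from triangles of positive area. *)
  assert (Hne : forall x y z,
    0 < det (square_boundary x) (square_boundary y) (square_boundary z) -> g x <> g y).
  { intros x y z H Heq.
    assert (Hpos : 0 < det (g x) (g y) (g z)).
    { unfold g; rewrite !par_boundary_affine, det_affine, edges_det.
      apply Rmult_lt_0_compat; assumption. }
    rewrite Heq in Hpos; unfold det in Hpos; lra. }
  assert (Hac : g 0 <> g 2).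
  { apply Hne with (2 + t); unfold det, square_boundary; split_sides. }
  assert (Hbd : g t <> g (2 + t)).
  { apply Hne with 0; unfold det, square_boundary; split_sides. }
  assert (Hfst : fst (square_boundary (2 + t))
     = fst (square_boundary 0) + fst (square_boundary 2) - fst (square_boundary t))
    by (unfold square_boundary; split_sides).
  assert (Hsnd : snd (square_boundary (2 + t))
     = snd (square_boundary 0) + snd (square_boundary 2) - snd (square_boundary t))
    by (unfold square_boundary; split_sides).
  exists (g 0), (g t), (g 2), (g (2 + t)).
  repeat split; try assumption.
  - apply Hne with (2 + t); unfold det, square_boundary; split_sides.
  - apply not_eq_sym, Hne with t; unfold det, square_boundary; split_sides.
  - apply Hne with 0; unfold det, square_boundary; split_sides.
  - apply Hne with t; unfold det, square_boundary; split_sides.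
  - left; exists 0, t, 2, (2 + t); repeat split; lra.
  - symmetry; apply ptol_parallelogram; try assumption;
      unfold g; rewrite !par_boundary_affine;
      unfold affine, padd, pscale; cbn [fst snd]; rewrite Hfst, Hsnd; ring.
Qed.

Lemma dist_par_boundary (p0 : pt) (r s al theta x y : R) :
  dist (par_boundary p0 r s al theta x) (par_boundary p0 r s al theta y)
  = sqrt (form (r ^ 2) (r * s * cos al) (s ^ 2)
            (square_boundary x) (square_boundary y) (square_boundary y)).
Proof.
  rewrite <- (polar_sqr r theta), <- (polar_sqr s (theta + al)).
  rewrite <- (edges_dot r s al theta), !par_boundary_affine.
  change (r * cos theta) with (fst (edge_u r theta)).
  change (r * sin theta) with (snd (edge_u r theta)).
  change (s * cos (theta + al)) with (fst (edge_w s al theta)).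
  change (s * sin (theta + al)) with (snd (edge_w s al theta)).
  rewrite <- (dot_affine p0); unfold dist, dot; f_equal; ring.
Qed.

Lemma par_boundary_lower (p0 : pt) (r s al theta : R) :
  0 < r -> 0 < s -> 0 < sin al -> 0 <= cos al ->
  let q := sqrt (r ^ 2 + 2 * r * s * cos al + s ^ 2) / (Rmin r s * sin al) in
  ptolemy_values (par_boundary p0 r s al theta) (1 / 2 * (q + 1 / q)).
Proof.
  intros Hr Hs Hsin Hcos q.
  assert (Hsc : sin al ^ 2 + cos al ^ 2 = 1)
    by (rewrite <- !Rsqr_pow2; apply sin2_cos2).
  assert (Hcos1 : cos al < 1) by nra.
  assert (Hlong : dist (par_boundary p0 r s al theta 0) (par_boundary p0 r s al theta 2)
                  = sqrt (r ^ 2 + 2 * r * s * cos al + s ^ 2)).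
  { rewrite dist_par_boundary; f_equal; unfold form, square_boundary; split_sides. }
  assert (Hmin : 0 < Rmin r s) by (apply Rmin_glb_lt; assumption).
  enough (exists t, 0 < t < 2 /\
    dist (par_boundary p0 r s al theta t) (par_boundary p0 r s al theta (2 + t))
    = Rmin r s * sin al) as (t & Ht & Hshort).
  { unfold q; rewrite <- Hlong, <- Hshort.
    apply par_boundary_symmetric_value; assumption. }
  (* [t] is the foot on a longer side of the perpendicular through the centre. *)
  destruct (Rle_dec s r) as [Hsr | Hrs].
  - rewrite Rmin_right by exact Hsr.
    set (z := s * cos al / r).
    assert (Hz : r * z = s * cos al) by (unfold z; field; lra).
    assert (Hz0 : 0 <= z).
    { apply Rmult_le_pos; [nra | left; apply Rinv_0_lt_compat; lra]. }
    assert (Hz1 : z < 1) by (apply Rmult_lt_reg_l with r; nra).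
    exists ((1 + z) / 2); split; [lra |].
    rewrite dist_par_boundary, <- (sqrt_pow2 (s * sin al)) by nra.
    f_equal; unfold form, square_boundary; split_sides.
    transitivity ((r * z) ^ 2 - 2 * (r * z) * (s * cos al) + s ^ 2); [field |].
    rewrite Hz.
    nra.
  - rewrite Rmin_left by lra.
    set (z := r * cos al / s).
    assert (Hz : s * z = r * cos al) by (unfold z; field; lra).
    assert (Hz0 : 0 <= z).
    { apply Rmult_le_pos; [nra | left; apply Rinv_0_lt_compat; lra]. }
    assert (Hz1 : z < 1) by (apply Rmult_lt_reg_l with s; nra).
    (* This side starts at parameter 1, at a corner with angle [PI - al]; hence the offset and the
       sign of [z]. *)
    exists (1 + (1 - z) / 2); split; [lra |].
    rewrite dist_par_boundary, <- (sqrt_pow2 (r * sin al)) by nra.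
    f_equal; unfold form, square_boundary; split_sides.
    transitivity ((s * z) ^ 2 - 2 * (s * z) * (r * cos al) + r ^ 2); [field |].
    rewrite Hz.
    nra.
Qed.

(** * The cotangent of the diagonal angle and the conclusion *)

(** With [c = cos al] and [d = sin al], the long diagonal has components [r + s c] along the long
    side and [s d] across it, so [k = cot beta]. *)
Lemma sqrt_ratio_cotangent (r s c d : R) :
  0 < s <= r -> 0 < d -> 0 <= c -> d ^ 2 + c ^ 2 = 1 ->
  let k := (r + s * c) / (s * d) in
  1 <= k /\ k * (r * s * d) = r ^ 2 + r * s * c /\
  sqrt (1 + k ^ 2) = sqrt (r ^ 2 + 2 * r * s * c + s ^ 2) / (s * d).
Proof.
  intros Hsr Hd Hc Hcd k.
  assert (Hsd : 0 < s * d) by nra.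
  assert (Hk : k * (s * d) = r + s * c) by (unfold k; field; lra).
  split; [| split].
  - apply Rmult_le_reg_r with (s * d); nra.
  - transitivity (r * (k * (s * d))); [ring | rewrite Hk; ring].
  - rewrite <- (sqrt_pow2 (s * d)) by lra.
    rewrite <- sqrt_div_alt by nra; f_equal.
    apply Rmult_eq_reg_r with ((s * d) ^ 2); [| nra].
    transitivity ((s * d) ^ 2 + (k * (s * d)) ^ 2); [ring |].
    rewrite Hk; unfold Rdiv; rewrite Rmult_assoc, Rinv_l by nra.
    nra.
Qed.

Theorem theorem1p5 (p0 : pt) (r s al theta : R) :
  0 < r -> 0 < s -> 0 < al <= PI / 2 ->
  let A := sqrt (r ^ 2 + 2 * r * s * cos al + s ^ 2) / (Rmin r s * sin al) in
  exists P : R,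
    is_ptolemy_constant (par_boundary p0 r s al theta) P /\
    (1 / 2) * (A + 1 / A) <= P /\ P <= A.
Proof.
  intros Hr Hs Hal A.
  assert (Hsin : 0 < sin al) by (apply sin_gt_0; pose proof PI_RGT_0; lra).
  assert (Hcos : 0 <= cos al) by (apply cos_ge_0; pose proof PI_RGT_0; lra).
  assert (Hsc : sin al ^ 2 + cos al ^ 2 = 1)
    by (rewrite <- !Rsqr_pow2; apply sin2_cos2).
  assert (Hub : is_upper_bound (ptolemy_values (par_boundary p0 r s al theta)) A).
  { destruct (Rle_dec s r) as [Hsr | Hrs].
    (* The condition on the longer side holds with equality by [H2]; the one on the shorter side
       follows from [s <= r]. *)
    - destruct (sqrt_ratio_cotangent r s (cos al) (sin al)) as (H1 & H2 & H3); try lra.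
      unfold A; rewrite Rmin_right, <- H3 by exact Hsr.
      apply par_boundary_upper; try assumption; nra.
    - destruct (sqrt_ratio_cotangent s r (cos al) (sin al)) as (H1 & H2 & H3); try lra.
      unfold A; rewrite Rmin_left by lra.
      replace (r ^ 2 + 2 * r * s * cos al + s ^ 2)
        with (s ^ 2 + 2 * s * r * cos al + r ^ 2) by ring.
      rewrite <- H3; apply par_boundary_upper; try assumption; nra. }
  pose proof (par_boundary_lower p0 r s al theta Hr Hs Hsin Hcos) as Hlow.
  destruct (completeness (ptolemy_values (par_boundary p0 r s al theta))) as [P HP].
  - exists A; exact Hub.
  - eexists; exact Hlow.
  - exists P; split; [exact HP |].
    destruct HP as [HP1 HP2]; split; [apply HP1; exact Hlow | apply HP2; exact Hub].
Qed.
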